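(* Let $\mathcal{D}_{\mathtt{outer}}$ denote a relaxed decision diagram of $\mathcal{Y}$. Then the model $$\begin{aligned}\min_{\mathbf{x},\mathbf{y},\boldsymbol{\lambda}}\quad&\mathbf{c}^\top\mathbf{x}+\mathbf{d}^\top\boldsymbol{\lambda}\\ \text{s.t.}\quad&\mathbf{T}^\top\boldsymbol{\lambda}=\mathbf{y},\\ &\mathbf{y}\in\operatorname{proj}_{\mathbf{y}}(\mathrm{NF}(\mathcal{D}_{\mathtt{outer}})),\\ &\mathbf{y}\in\operatorname{rel}(\mathcal{Y}),\\ &\mathbf{y}\in\mathcal{S}(\mathbf{x}),\\ &\mathbf{x}\in\mathcal{X},\ \boldsymbol{\lambda}\ge\mathbf{0}\end{aligned}$$ generates a feasible solution $\mathbf{x}\in\mathcal{X}$ (the $\mathbf{x}$-component of any optimal solution), and its optimal value is a lower bound on the optimal objective value of $$\min_{\mathbf{x}\in\mathcal{X}}\ \max_{\boldsymbol{\xi}\in\Xi}\ \min_{\mathbf{y}\in\mathcal{Y}\cap\mathcal{S}(\mathbf{x})}\ \mathbf{c}^\top\mathbf{x}+\boldsymbol{\xi}^\top\mathbf{y}.$$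
   Context: Problem data: $m,n$ are positive integers, $\mathbf{c}\in\mathbb{R}^m$, $\mathcal{X}\subseteq\{0,1\}^m$, $\mathcal{Y}=\{\mathbf{y}\in\{0,1\}^n\mid\mathbf{G}\mathbf{y}\ge\mathbf{h}\}$ for a real matrix $\mathbf{G}$ and real vector $\mathbf{h}$, with continuous relaxation $\operatorname{rel}(\mathcal{Y})=\{\mathbf{y}\in[0,1]^n\mid\mathbf{G}\mathbf{y}\ge\mathbf{h}\}$, and $\Xi=\{\boldsymbol{\xi}\in\mathbb{R}^n\mid\mathbf{T}\boldsymbol{\xi}\le\mathbf{d}\}$ is a nonempty bounded polyhedron. The problem has selective adaptability: for pairwise disjoint $\mathcal{U}_1,\mathcal{U}_2,\mathcal{U}_3\subseteq\{1,\ldots,n\}\times\{1,\ldots,m\}$, $$\mathcal{S}(\mathbf{x})=\{\mathbf{y}\in\mathbb{R}^n\mid y_i\le x_j\ \forall(i,j)\in\mathcal{U}_1,\ y_i=x_j\ \forall(i,j)\in\mathcal{U}_2,\ y_i\ge x_j\ \forall(i,j)\in\mathcal{U}_3\}.$$ The minimum over an empty (infeasible) set is $+\infty$. Decision diagram: a directed acyclic (multi)graph $\mathcal{D}=(\mathcal{V},\mathcal{A})$ whose nodes are partitioned into $n+1$ nonempty layers $\mathcal{V}_1,\ldots,\mathcal{V}_{n+1}$ with $\mathcal{V}_1=\{\mathtt{r}\}$ and $\mathcal{V}_{n+1}=\{\mathtt{t}\}$; each arc goes from a node of $\mathcal{V}_i$ to a node of $\mathcal{V}_{i+1}$ for some $i\in\{1,\ldots,n\}$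 and carries a label 0 or 1. $\mathcal{A}_i^1$ is the set of arcs with label 1 leaving nodes of $\mathcal{V}_i$. A path from $\mathtt{r}$ to $\mathtt{t}$ maps to the vector $\mathbf{y}\in\{0,1\}^n$ with $y_i$ equal to the label of its arc leaving layer $i$. A relaxed decision diagram of $\mathcal{Y}$ is one whose $\mathtt{r}$–$\mathtt{t}$ paths map to a set of vectors that is a superset of $\mathcal{Y}$. Network flow polyhedron: $$\mathrm{NF}(\mathcal{D})=\Big\{(\mathbf{y},\mathbf{z})\in\mathbb{R}^n\times\mathbb{R}_+^{|\mathcal{A}|}\ \Big|\ \mathbf{A}\mathbf{z}=\mathbf{b},\ y_i=\sum_{j\in\mathcal{A}_i^1}z_j\ \forall i\in\{1,\ldots,n\}\Big\},$$ where $\mathbf{A}\in\{-1,0,1\}^{|\mathcal{V}|\times|\mathcal{A}|}$ is the node-arc incidence matrix (entry $-1$ at the tail and $+1$ at the head of each arc), and $\mathbf{b}$ is zero except for $-1$ at $\mathtt{r}$ and $1$ at $\mathtt{t}$. $\operatorname{proj}_{\mathbf{y}}$ denotes projection onto the $\mathbf{y}$ coordinates. *)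

(* Defs.v *)
(* Vectors of R^k are column matrices. *)
From HB Require Import structures.
From mathcomp Require Import all_boot all_order all_algebra.
From mathcomp Require Import all_classical all_reals all_analysis.
Set Implicit Arguments.
Unset Strict Implicit.
Unset Printing Implicit Defensive.
Import Order.TTheory GRing.Theory Num.Theory.
Import numFieldNormedType.Exports.
Local Open Scope classical_set_scope.
Local Open Scope ring_scope.

Section Vectors.
Variable R : realType.

Definition dotv k (u v : 'cV[R]_k) : R := (u^T *m v) 0 0.

Definition lev k (u v : 'cV[R]_k) : Prop := forall i, u i 0 <= v i 0.

Definition binary_vectors k : set 'cV[R]_k :=
  [set v : 'cV[R]_k | forall i, v i 0 = 0 \/ v i 0 = 1].

Definition binary_points q n (G : 'M[R]_(q, n)) (h : 'cV[R]_q) :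
    set 'cV[R]_n :=
  [set y : 'cV[R]_n | binary_vectors y /\ lev h (G *m y)].

Definition relaxation q n (G : 'M[R]_(q, n)) (h : 'cV[R]_q) :
    set 'cV[R]_n :=
  [set y : 'cV[R]_n | (forall i, 0 <= y i 0 <= 1) /\ lev h (G *m y)].

Definition uncertainty_set p n (T : 'M[R]_(p, n)) (d : 'cV[R]_p) :
    set 'cV[R]_n :=
  [set xi : 'cV[R]_n | lev (T *m xi) d].

Definition selective m n (U1 U2 U3 : {set 'I_n * 'I_m}) (x : 'cV[R]_m) :
    set 'cV[R]_n :=
  [set y : 'cV[R]_n | [/\ forall i j, (i, j) \in U1 -> y i 0 <= x j 0,
               forall i j, (i, j) \in U2 -> y i 0 = x j 0 &
               forall i j, (i, j) \in U3 -> x j 0 <= y i 0]].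

End Vectors.

(* Layers are numbered from 0 to n, so the arcs leaving layer i : 'I_n carry
   the value of the coordinate y_i.  Since every arc increases the layer by
   one, the multigraph is acyclic. *)
Record decision_diagram (n : nat) := DecisionDiagram {
  dd_node : finType;
  dd_arc : finType;
  dd_layer : dd_node -> 'I_n.+1;
  dd_tail : dd_arc -> dd_node;
  dd_head : dd_arc -> dd_node;
  dd_label : dd_arc -> bool;
  dd_root : dd_node;
  dd_terminal : dd_node;
  dd_layer_nonempty : forall i, exists v, dd_layer v = i;
  dd_rootP : forall v, dd_layer v = ord0 <-> v = dd_root;
  dd_terminalP : forall v, dd_layer v = ord_max <-> v = dd_terminal;
  dd_layer_arc : forall a,
    dd_layer (dd_head a) = (dd_layer (dd_tail a)).+1 :> nat
}.

Section Diagrams.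
Variables (R : realType) (n : nat) (D : decision_diagram n).

Fixpoint dd_path (u : dd_node D) (s : seq (dd_arc D)) (v : dd_node D) : bool :=
  if s is a :: s' then (dd_tail a == u) && dd_path (dd_head a) s' v
  else u == v.

(* A root-terminal path has exactly one arc leaving each layer i < n, so
   the existential below determines y. *)
Definition dd_path_vector (s : seq (dd_arc D)) (y : 'cV[R]_n) : Prop :=
  forall i : 'I_n, exists2 a, a \in s &
    dd_layer (dd_tail a) = i :> nat /\ y i 0 = (dd_label a)%:R.

Definition dd_vectors : set 'cV[R]_n :=
  [set y : 'cV[R]_n | exists s,
     dd_path (dd_root D) s (dd_terminal D) /\ dd_path_vector s y].

Definition relaxed_dd (Y : set 'cV[R]_n) : Prop := Y `<=` dd_vectors.

Definition incidence_mx : 'M[R]_(#|dd_node D|, #|dd_arc D|) :=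
  \matrix_(v, a) ((enum_val v == dd_head (enum_val a))%:R
                  - (enum_val v == dd_tail (enum_val a))%:R).

Definition unit_flow_rhs : 'cV[R]_#|dd_node D| :=
  \col_v ((enum_val v == dd_terminal D)%:R - (enum_val v == dd_root D)%:R).

Definition network_flow : set ('cV[R]_n * 'cV[R]_#|dd_arc D|) :=
  [set yz : 'cV[R]_n * 'cV[R]_#|dd_arc D| | [/\ lev 0 yz.2,
                incidence_mx *m yz.2 = unit_flow_rhs &
                forall i : 'I_n, yz.1 i 0 =
                  \sum_(a : 'I_#|dd_arc D| |
                        dd_label (enum_val a) &&
                        (dd_layer (dd_tail (enum_val a)) == i :> nat))
                     yz.2 a 0]].

End Diagrams.

Section Problems.
Variables (R : realType) (m n p q : nat).
Variables (c : 'cV[R]_m) (X : set 'cV[R]_m).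
Variables (G : 'M[R]_(q, n)) (h : 'cV[R]_q).
Variables (T : 'M[R]_(p, n)) (d : 'cV[R]_p).
Variables (U1 U2 U3 : {set 'I_n * 'I_m}).

(* In \bar R, ereal_inf set0 = +oo, the convention for infeasible minima. *)
Definition two_stage_value : \bar R :=
  ereal_inf [set
    ereal_sup [set
      ereal_inf [set (dotv c x + dotv xi y)%:E |
        y in binary_points G h `&` selective U1 U2 U3 x] |
      xi in uncertainty_set T d] |
    x in X].

Variable D : decision_diagram n.

Definition dd_model_feasible : set ('cV[R]_m * 'cV[R]_n * 'cV[R]_p) :=
  [set w : 'cV[R]_m * 'cV[R]_n * 'cV[R]_p | let: (x, y, lam) := w in
    [/\ T^T *m lam = y,
        (fst @` @network_flow R n D) y,
        relaxation G h y,
        selective U1 U2 U3 x y &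
        X x /\ lev 0 lam]].

Definition dd_model_objective (w : 'cV[R]_m * 'cV[R]_n * 'cV[R]_p) : R :=
  let: (x, y, lam) := w in dotv c x + dotv d lam.

Definition dd_model_optimal (w : 'cV[R]_m * 'cV[R]_n * 'cV[R]_p) : Prop :=
  dd_model_feasible w /\
  forall w', dd_model_feasible w' ->
    dd_model_objective w <= dd_model_objective w'.

Definition dd_model_value : \bar R :=
  ereal_inf [set (dd_model_objective w)%:E | w in dd_model_feasible].

End Problems.

(* Main.v *)
Require Import Defs.
From HB Require Import structures.
From mathcomp Require Import all_boot all_order all_algebra.
From mathcomp Require Import all_classical all_reals all_analysis.
Set Implicit Arguments.
Unset Strict Implicit.
Unset Printing Implicit Defensive.
Import Order.TTheory GRing.Theory Num.Theory.
Import numFieldNormedType.Exports.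
Local Open Scope classical_set_scope.
Local Open Scope ring_scope.

(** Fix a first-stage decision [x], let [F] be the finite set of binary
    second-stage decisions compatible with [x], and let [Q] be the polyhedron
    obtained from [F] by replacing the binary points by their linear relaxation
    and by the projection of the network flows.  The adversary wants to find a
    [xi] with [T xi <= d] such that [xi . y >= v] for every [y] in [F]: this is
    a finite system of linear inequalities, so if it has no solution then
    Farkas' lemma gives multipliers [lam] for [T xi <= d] and [mu] for the
    points of [F].  Normalised so that the entries of [mu] sum to 1, they say
    that [T^T lam] is the convex combination of [F] with weights [mu] and that
    [d . lam <= v] ([robust_dual]).  As [Q] is convex and contains [F], the
    triple [(x, T^T lam, lam)] is feasible in the decision diagram model, with
    value at most [c . x + v].  Letting [v] decrease to the worst-case value of
    the second stage yields the lower bound.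

    That [Q] contains [F] rests on the diagram being relaxed: a point of [F] is
    read along a root-terminal path, and the indicator function of that path is
    a unit flow ([network_flow_dd_vectors]).

    For the existence of an optimal solution, the model with [x] fixed is a
    linear program in [lam].  Weak duality against one scenario [xi] bounds it
    below by [xi . y], hence by a constant since [0 <= y <= 1]; a linear form
    bounded below on a nonempty polyhedron attains its minimum
    ([polyhedral_min]).  There are only finitely many binary [x] to compare.

    Both linear programming facts come from Fourier-Motzkin elimination
    ([fourier_motzkin]): the infeasibility certificate gives Farkas' lemma, and
    the fact that one finite family of multipliers decides feasibility for all
    right-hand sides shows that linear images of polyhedra are polyhedra. *)

(** * Fourier-Motzkin elimination *)

Lemma dotvE (R : realType) k (u v : 'cV[R]_k) :
  dotv u v = \sum_i u i 0 * v i 0.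
Proof. by rewrite /dotv mxE; apply: eq_bigr => i _; rewrite mxE. Qed.

Lemma lev_mulmx (R : realType) r p (C : 'M[R]_(r, p)) (u v : 'cV[R]_p) :
  (forall i j, 0 <= C i j) -> lev u v -> lev (C *m u) (C *m v).
Proof.
move=> C0 uv i; rewrite !mxE; apply: ler_sum => j _.
by rewrite ler_wpM2l.
Qed.

(** The rows with [a i < 0] bound [t] below by [b i / a i] and those with
    [0 < a i] bound it above; the second hypothesis, cleared of denominators,
    says that each lower bound is at most each upper bound.  The largest lower
    bound, or else the smallest upper bound, is then a solution. *)
Lemma scalar_between (R : realType) (I : finType) (a b : I -> R) :
  (forall i, a i = 0 -> 0 <= b i) ->
  (forall i j, 0 < a i -> a j < 0 -> 0 <= a i * b j - a j * b i) ->
  exists t, forall i, a i * t <= b i.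
Proof.
move=> b0 bij.
have H t : (forall i, 0 < a i -> t <= b i / a i) ->
    (forall i, a i < 0 -> b i / a i <= t) -> exists t, forall i, a i * t <= b i.
  move=> tP tN; exists t => i; case: (ltgtP (a i) 0) => ai.
  - by move: (tN i ai); rewrite ler_ndivrMr// mulrC.
  - by move: (tP i ai); rewrite ler_pdivlMr// mulrC.
  - by rewrite ai mul0r b0.
have [[j0 j0N]|noN] := pselect (exists j, a j < 0).
  case: (@arg_maxP _ _ _ j0 [pred j | a j < 0] (fun j => b j / a j) j0N).
  move=> j /= jN jmax.
  apply: (H (b j / a j)) => i ai; last exact: jmax.
  rewrite ler_pdivlMr// mulrAC ler_ndivrMr//.
  by move: (bij i j ai jN); rewrite subr_ge0 mulrC [a i * _]mulrC.
have N0 j : a j < 0 -> False by move=> aj; apply: noN; exists j.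
have [[i0 i0P]|noP] := pselect (exists i, 0 < a i).
  case: (@arg_minP _ _ _ i0 [pred i | 0 < a i] (fun i => b i / a i) i0P).
  move=> i /= iP imin.
  by apply: (H (b i / a i)) => j aj; [exact: imin|case: (N0 j aj)].
apply: (H 0) => i ai; last by case: (N0 i ai).
by case: noP; exists i.
Qed.

(** The rows of [C] are the nonnegative combinations of one or two rows of [a]
    that cancel: a row where [a] vanishes, or a row with a positive entry and a
    row with a negative one, each weighted by the modulus of the entry of the
    other. *)
Lemma eliminate_column (R : realType) p (a : 'cV[R]_p) :
  exists r (C : 'M[R]_(r, p)),
    [/\ forall i j, 0 <= C i j, C *m a = 0 &
        forall b, lev 0 (C *m b) -> exists t : 'cV[R]_1, lev (a *m t) b].
Proof.
(* Pairs of rows that give no combination contribute the zero row. *)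
pose w (ij : 'I_p * 'I_p) : 'rV[R]_p :=
  if (0 < a ij.1 0) && (a ij.2 0 < 0) then
    a ij.1 0 *: delta_mx 0 ij.2 - a ij.2 0 *: delta_mx 0 ij.1
  else if a ij.1 0 == 0 then delta_mx 0 ij.1 else 0.
pose C : 'M[R]_(#|{: 'I_p * 'I_p}|, p) := \matrix_k w (enum_val k).
have Cb (b : 'cV[R]_p) i j :
    (C *m b) (enum_rank (i, j)) 0 = (w (i, j) *m b) 0 0.
  rewrite !mxE; apply: eq_bigr => k _.
  by rewrite mxE enum_rankK.
have wb (b : 'cV[R]_p) i j : (w (i, j) *m b) 0 0 =
    if (0 < a i 0) && (a j 0 < 0) then a i 0 * b j 0 - a j 0 * b i 0
    else if a i 0 == 0 then b i 0 else 0.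
  rewrite /w /=; case: ifP => _.
    by rewrite mulmxBl -!scalemxAl -!rowE !mxE.
  by case: ifP => _; rewrite ?mul0mx -?rowE mxE.
exists _, C; split.
- move=> k j; rewrite mxE /w; case: ifP => [/andP[i0 j0]|_].
    rewrite !mxE addr_ge0//; first by rewrite mulr_ge0// ltW.
    by rewrite oppr_ge0 mulr_le0_ge0// ltW.
  by case: ifP => _; rewrite mxE// ler0n.
- apply/matrixP => k k1.
  rewrite ord1 -[k]enum_valK [enum_val k]surjective_pairing.
  rewrite Cb wb [RHS]mxE; case: ifP => _; first by rewrite mulrC subrr.
  by case: ifP => // /eqP.
- move=> b b0.
  have [i|i j ai aj|t tP] := @scalar_between R 'I_p (a^~ 0) (b^~ 0).
  + move=> ai; move: (b0 (enum_rank (i, i))).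
    by rewrite Cb wb mxE ai ltxx eqxx.
  + by move: (b0 (enum_rank (i, j))); rewrite Cb wb mxE ai aj.
  exists t%:M => i; rewrite mul_mx_scalar mxE mulrC; exact: tP.
Qed.

(** The multipliers [C] do not depend on [b].  This uniformity is what makes
    projections of polyhedra polyhedral; for a single [b], the statement is
    Farkas' lemma. *)
Lemma fourier_motzkin (R : realType) p k (A : 'M[R]_(p, k)) :
  exists r (C : 'M[R]_(r, p)),
    [/\ forall i j, 0 <= C i j, C *m A = 0 &
        forall b, lev 0 (C *m b) -> exists x, lev (A *m x) b].
Proof.
elim: k p A => [|k IH] p A.
  exists p, 1%:M; split; first by move=> i j; rewrite mxE ler0n.
    by apply/matrixP => i [].
  by move=> b; rewrite mul1mx => b0; exists 0; rewrite mulmx0.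
have [r [C [C0 Ca Cb]]] := @eliminate_column R p (@lsubmx R p 1 k A).
have [s [E [E0 EA Eb]]] := IH r (C *m @rsubmx R p 1 k A).
exists s, (E *m C); split.
- by move=> i j; rewrite mxE sumr_ge0// => l _; rewrite mulr_ge0.
- rewrite -[A](@hsubmxK _ p 1 k) (@mul_mx_row R s p 1 k) -!mulmxA Ca EA mulmx0.
  exact: (@row_mx0 _ s 1 k).
move=> b; rewrite -mulmxA => /Eb[x xP].
have [|t tP] := Cb (b - @rsubmx R p 1 k A *m x).
  move=> i; rewrite mulmxBr mulmxA [leLHS]mxE !mxE subr_ge0.
  by move: (xP i); rewrite !mxE.
exists (col_mx t x).
rewrite -[A](@hsubmxK _ p 1 k) (@mul_row_col _ p 1 k 1) => i.
by move: (tP i); rewrite !mxE lerBrDr.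
Qed.

(** * Polyhedra *)

Definition polyhedral (R : realType) k (P : set 'cV[R]_k) : Prop :=
  exists p (A : 'M[R]_(p, k)) b, forall x, P x <-> lev (A *m x) b.

Section Polyhedral.
Variable R : realType.

Lemma lev_col_mx p1 p2 (u1 v1 : 'cV[R]_p1) (u2 v2 : 'cV[R]_p2) :
  lev (col_mx u1 u2) (col_mx v1 v2) <-> lev u1 v1 /\ lev u2 v2.
Proof.
split=> [le12|[le1 le2] i].
  by split=> i; [move: (le12 (lshift p2 i))|move: (le12 (rshift p1 i))];
    rewrite ?col_mxEu ?col_mxEd.
by rewrite !mxE; case: fintype.split.
Qed.

Lemma polyhedral_lev_r k (u : 'cV[R]_k) : polyhedral [set x | lev x u].
Proof. by exists k, 1%:M, u => x; rewrite mul1mx. Qed.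

Lemma polyhedral_lev_l k (u : 'cV[R]_k) : polyhedral [set x | lev u x].
Proof.
exists k, (- 1%:M), (- u) => x; rewrite mulNmx mul1mx.
by split=> ux i; move: (ux i); rewrite !mxE lerN2.
Qed.

Lemma polyhedralI k (P Q : set 'cV[R]_k) :
  polyhedral P -> polyhedral Q -> polyhedral (P `&` Q).
Proof.
move=> [p [A [a Pa]]] [q [B [b Qb]]].
exists (p + q)%N, (col_mx A B), (col_mx a b) => x.
by rewrite mul_col_mx lev_col_mx -Pa -Qb.
Qed.

Lemma polyhedral_forall k (I : finType) (D : pred I) (P : I -> set 'cV[R]_k) :
  (forall i, D i -> polyhedral (P i)) ->
  polyhedral [set x | forall i, D i -> P i x].
Proof.
move=> polyP.
have polys (s : seq I) : polyhedral [set x | forall i, i \in s -> D i -> P i x].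
  elim: s => [|j s IHs]; first by exists 0%N, 0, 0 => x; split=> // _ [].
  have polyj : polyhedral [set x | D j -> P j x].
    have [Dj|nDj] := boolP (D j).
      have [p [A [b Pj]]] := polyP j Dj.
      by exists p, A, b => x; rewrite -Pj /=; split; auto.
    by exists 0%N, 0, 0 => x; split=> // _ [].
  have [p [A [b Ps]]] := polyhedralI polyj IHs.
  exists p, A, b => x; rewrite -Ps; split=> [Px|[Pj Pr] i].
    by split=> [|i si]; apply: Px; rewrite inE ?eqxx ?si ?orbT.
  by rewrite inE => /predU1P[->|]; auto.
have [p [A [b Pe]]] := polys (enum I).
exists p, A, b => x; rewrite -Pe; split=> Px i; first by move=> _; exact: Px.
by apply: Px; rewrite mem_enum.
Qed.

Lemma polyhedral_preimage k l (M : 'M[R]_(k, l)) (P : set 'cV[R]_k) :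
  polyhedral P -> polyhedral [set x | P (M *m x)].
Proof.
by move=> [p [A [b Pb]]]; exists p, (A *m M), b => x; rewrite -mulmxA -Pb.
Qed.

Lemma polyhedral_coord_le k (i : 'I_k) (r : R) :
  polyhedral [set x : 'cV[R]_k | x i 0 <= r].
Proof.
exists 1%N, (delta_mx 0 i), r%:M => x; rewrite -rowE.
split=> [xr j|/(_ 0)]; last by rewrite !mxE.
by rewrite ord1 !mxE.
Qed.

Lemma polyhedral_coord_ge k (i : 'I_k) (r : R) :
  polyhedral [set x : 'cV[R]_k | r <= x i 0].
Proof.
exists 1%N, (- delta_mx 0 i), (- r)%:M => x; rewrite mulNmx -rowE.
split=> [xr j|/(_ 0)]; last by rewrite !mxE lerN2.
by rewrite ord1 !mxE lerN2.
Qed.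

Lemma polyhedral_coord_eq k (i : 'I_k) (r : R) :
  polyhedral [set x : 'cV[R]_k | x i 0 = r].
Proof.
have [p [A [b Pb]]] :=
  polyhedralI (polyhedral_coord_le i r) (polyhedral_coord_ge i r).
exists p, A, b => x; rewrite -Pb.
split=> [/= ->|[/= xr rx]]; first by split=> /=.
by apply/eqP; rewrite eq_le xr.
Qed.

(** Membership of [y] in the image is the feasibility in [x] of [A x <= b],
    [M x <= y], [- M x <= - y].  Elimination of [x] turns it into inequalities
    between the right-hand sides, and these are affine in [y]. *)
Lemma polyhedral_image k l (M : 'M[R]_(l, k)) (P : set 'cV[R]_k) :
  polyhedral P -> polyhedral [set M *m x | x in P].
Proof.
move=> [p [A [b Pb]]].
have [r [C [C0 CA Cb]]] := fourier_motzkin (col_mx A (col_mx M (- M))).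
(* [b' + K y] is the right-hand side of that system. *)
pose K : 'M[R]_(p + (l + l), l) := col_mx 0 (col_mx 1%:M (- 1%:M)).
pose b' : 'cV[R]_(p + (l + l)) := col_mx b (col_mx 0 0).
have KE y : b' + K *m y = col_mx b (col_mx y (- y)).
  by rewrite /b' /K !mul_col_mx mulNmx mul1mx mul0mx !add_col_mx addr0 !add0r.
exists r, (- (C *m K)), (C *m b') => y.
have -> : lev (- (C *m K) *m y) (C *m b') <-> lev 0 (C *m (b' + K *m y)).
  have E i : (C *m (b' + K *m y)) i 0 = (C *m b') i 0 - (- (C *m K) *m y) i 0.
    by rewrite mulmxDr mulNmx mulmxA mxE [X in _ = _ - X]mxE opprK.
  by split=> Cy i; move: (Cy i); rewrite E [X in X <= _ - _]mxE subr_ge0.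
rewrite KE; split=> [[x /Pb Ax <-]|/Cb[x]].
  rewrite -[0](mul0mx _ x) -CA -mulmxA; apply: lev_mulmx => //.
  rewrite !mul_col_mx mulNmx; apply/lev_col_mx; split=> // i; exact: lexx.
rewrite !mul_col_mx mulNmx => /lev_col_mx[/Pb Px /lev_col_mx[le1 le2]].
exists x => //; apply/matrixP => i j; rewrite ord1; apply/eqP.
by rewrite eq_le le1; move: (le2 i); rewrite !mxE lerN2.
Qed.

Lemma polyhedral_convex k r (P : set 'cV[R]_k) (Y : 'M[R]_(k, r))
    (mu : 'cV[R]_r) :
  polyhedral P -> (forall j, P (col j Y)) -> lev 0 mu ->
  \sum_j mu j 0 = 1 -> P (Y *m mu).
Proof.
move=> [p [A [b Pb]]] PY mu0 mu1; apply/Pb => i.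
rewrite mulmxA mxE -[leRHS]mulr1 -mu1 mulr_sumr; apply: ler_sum => j _.
apply: ler_wpM2r; first by move: (mu0 j); rewrite mxE.
by have /Pb/(_ i) := PY j; rewrite colE mulmxA -colE mxE.
Qed.

(** A nonempty polyhedron of the line is bounded below only if some inequality
    has a negative coefficient, for otherwise it would contain every point to
    the left of any of its points; the tightest such inequality is then
    attained. *)
Lemma polyhedral_line_min (Q : set 'cV[R]_1) L : polyhedral Q -> Q !=set0 ->
  (forall t, Q t -> L <= t 0 0) ->
  exists t, Q t /\ forall s, Q s -> t 0 0 <= s 0 0.
Proof.
move=> [p [A [b Qb]]] [t0 Qt0] QL.
have QbE t : Q t <-> forall i, A i 0 * t 0 0 <= b i 0.
  rewrite Qb; split=> At i; move: (At i);
  by rewrite [(_ *m _) i 0]mxE big_ord1.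
have [[j0 j0N]|noN] := pselect (exists j, A j 0 < 0); last first.
  (* [L - 1] lies to the left of a point of [Q], but below the bound [L]. *)
  have /QL : Q (L - 1)%:M.
    apply/QbE => i; rewrite [X in _ * X]mxE eqxx mulr1n.
    apply: le_trans ((QbE t0).1 Qt0 i).
    have A0 : 0 <= A i 0.
      by rewrite leNgt; apply/negP => Ai; apply: noN; exists i.
    by rewrite ler_wpM2l// (le_trans _ (QL _ Qt0))// gerBl ler01.
  by rewrite mxE eqxx mulr1n lerBrDl gerDr ler10.
case: (@arg_maxP _ _ _ j0 [pred j | A j 0 < 0] (fun j => b j 0 / A j 0) j0N).
move=> j /= jN jmax.
have lb s : Q s -> b j 0 / A j 0 <= s 0 0.
  by move=> /QbE/(_ j); rewrite ler_ndivrMr// mulrC.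
exists (b j 0 / A j 0)%:M; split=> [|s Qs]; last by rewrite mxE eqxx mulr1n lb.
apply/QbE => i; rewrite [X in _ * X]mxE eqxx mulr1n.
have [Ai|Ai] := ltP (A i 0) 0.
  by rewrite mulrC -ler_ndivrMr//; exact: jmax.
apply: le_trans ((QbE t0).1 Qt0 i); rewrite ler_wpM2l//; exact: lb.
Qed.

(** The set of values of [f] on [P] is itself a polyhedron, of the line. *)
Lemma polyhedral_min k (P : set 'cV[R]_k) (f : 'cV[R]_k) L :
  polyhedral P -> P !=set0 -> (forall x, P x -> L <= dotv f x) ->
  exists x, P x /\ forall y, P y -> dotv f x <= dotv f y.
Proof.
move=> polyP [x0 Px0] PL.
have [||_ [[x Px <-] xmin]] :=
  polyhedral_line_min (polyhedral_image f^T polyP) (L := L).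
- by exists (f^T *m x0), x0.
- by move=> _ [x Px <-]; exact: PL.
by exists x; split=> // y Py; apply: xmin; exists y.
Qed.

End Polyhedral.

(** * Duality for the uncertainty set *)

Section Duality.
Variable R : realType.

Lemma dotvC k (u v : 'cV[R]_k) : dotv u v = dotv v u.
Proof. by rewrite !dotvE; apply: eq_bigr => i _; rewrite mulrC. Qed.

Lemma weak_duality n p (T : 'M[R]_(p, n)) (d lam : 'cV[R]_p) (xi : 'cV[R]_n) :
  uncertainty_set T d xi -> lev 0 lam -> dotv xi (T^T *m lam) <= dotv d lam.
Proof.
move=> Txi lam0.
have -> : dotv xi (T^T *m lam) = dotv (T *m xi) lam.
  by rewrite /dotv trmx_mul mulmxA.
rewrite !dotvE; apply: ler_sum => i _; apply: ler_wpM2r (Txi i).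
by move: (lam0 i); rewrite mxE.
Qed.

(** This is the minimax exchange behind the lower bound.  By hypothesis no
    [xi] satisfies both [T xi <= d] and [xi . y >= v] for all [y] in [F];
    Farkas' multipliers [lam0], [mu0] satisfy [T^T lam0 = Y mu0], where the
    columns of [Y] are the points of [F], and [d . lam0 < v * \sum mu0].
    Division by [\sum mu0] makes [T^T lam0] a convex combination of [F]. *)
Lemma robust_dual n p (T : 'M[R]_(p, n)) (d : 'cV[R]_p) (F Q : set 'cV[R]_n) v :
  uncertainty_set T d !=set0 -> finite_set F -> polyhedral Q -> F `<=` Q ->
  (forall xi, uncertainty_set T d xi -> exists2 y, F y & dotv xi y < v) ->
  exists lam, [/\ lev 0 lam, Q (T^T *m lam) & dotv d lam <= v].
Proof.
move=> [xi0 Txi0] /finite_seqP[s ->{F}] polyQ sQ minF.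
pose Y : 'M[R]_(n, size s) := \matrix_(i, j) (tnth (in_tuple s) j) i 0.
have colY j : col j Y = tnth (in_tuple s) j.
  by apply/matrixP => i k; rewrite ord1 !mxE.
pose b : 'cV[R]_(p + size s) := col_mx d (const_mx (- v)).
have [r [C [C0 CN Cb]]] := fourier_motzkin (col_mx T (- Y^T)).
have [i Ci] : exists i, (C *m b) i 0 < 0.
  apply: contrapT => noi.
  have [i|xi] := Cb b.
    by rewrite mxE leNgt; apply/negP => Ci; apply: noi; exists i.
  rewrite mul_col_mx mulNmx => /lev_col_mx[/minF[y ys yv] le2].
  have [j yj] : exists j, y = tnth (in_tuple s) j.
    by apply/tnthP.
  have YE : (Y^T *m xi) j 0 = dotv xi y.
    by rewrite yj -colY dotvE mxE; apply: eq_bigr => k _; rewrite !mxE mulrC.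
  by move: (le2 j); rewrite mxE YE [X in _ <= X]mxE lerN2 leNgt yv.
pose lam0 : 'cV[R]_p := (lsubmx (row i C))^T.
pose mu0 : 'cV[R]_(size s) := (rsubmx (row i C))^T.
have rowC : row i C = row_mx lam0^T mu0^T by rewrite !trmxK hsubmxK.
have lam00 : lev 0 lam0 by move=> j; rewrite !mxE.
have mu00 : lev 0 mu0 by move=> j; rewrite !mxE.
have Tlam0 : T^T *m lam0 = Y *m mu0.
  apply: trmx_inj; rewrite !trmx_mul (trmxK T); apply/eqP.
  by rewrite -subr_eq0 -mulmxN -mul_row_col -rowC -row_mul CN row0.
have val0 : dotv d lam0 < v * \sum_j mu0 j 0.
  have -> : v * (\sum_j mu0 j 0) = - dotv mu0 (const_mx (- v)).
    rewrite dotvE mulr_sumr -sumrN; apply: eq_bigr => j _.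
    by rewrite [const_mx _ _ _]mxE mulrN opprK mulrC.
  rewrite dotvC -subr_lt0 opprK; move: Ci.
  have -> : (C *m b) i 0 = (row i C *m b) 0 0 by rewrite -row_mul [RHS]mxE.
  by rewrite rowC mul_row_col mxE.
have S0 : 0 <= \sum_j mu0 j 0.
  by apply: sumr_ge0 => j _; move: (mu00 j); rewrite mxE.
move: S0; rewrite le_eqVlt => /predU1P[S0|S0].
  (* If [mu0] vanishes, then [lam0] certifies that the uncertainty set is empty,
     contrary to [xi0]. *)
  have mu0E : mu0 = 0.
    apply/matrixP => j k; rewrite ord1 [RHS]mxE.
    apply: (psumr_eq0P _ (esym S0)) => // l _.
    by move: (mu00 l); rewrite mxE.
  move: val0; rewrite -S0 mulr0 ltNge => /negP[].
  apply: le_trans (weak_duality Txi0 lam00).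
  by rewrite Tlam0 mu0E mulmx0 /dotv mulmx0 mxE.
set S := \sum_j mu0 j 0 in val0 S0.
exists (S^-1 *: lam0); split.
- by move=> j; rewrite !mxE mulr_ge0// invr_ge0 ltW.
- rewrite -scalemxAr Tlam0 scalemxAr; apply: polyhedral_convex => // [j|j|].
  + by rewrite colY; apply: sQ; rewrite /= mem_tnth.
  + by rewrite !mxE mulr_ge0// invr_ge0 ltW.
  + under eq_bigr do rewrite mxE.
    by rewrite -mulr_sumr mulVf// gt_eqF.
- by rewrite /dotv -scalemxAr mxE ler_pdivrMl// mulrC ltW.
Qed.
End Duality.

(** * Paths and network flows *)

Section Flows.
Variables (R : realType) (n : nat) (D : decision_diagram n).
Implicit Types (u : dd_node D) (s : seq (dd_arc D)).

(** Layers increase by exactly one along a path, so a path uses no arc twice and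
    crosses each layer exactly once. *)
Lemma dd_path_layers u s v : dd_path u s v ->
  [seq (dd_layer (dd_tail a) : nat) | a <- s] = iota (dd_layer u) (size s).
Proof.
elim: s u => //= a s IHs u /andP[/eqP au /IHs ->].
by rewrite dd_layer_arc au.
Qed.

(** The net inflow at a node [w] along a path telescopes to its endpoints; for a
    root-terminal path this is flow conservation at [w]. *)
Lemma dd_path_telescope (w : dd_node D) u s v : dd_path u s v ->
  \sum_(a <- s) ((w == dd_head a)%:R - (w == dd_tail a)%:R) =
  (w == v)%:R - (w == u)%:R :> R.
Proof.
elim: s u => [|a s IHs] u /=; first by move=> /eqP ->; rewrite big_nil subrr.
by move=> /andP[/eqP <- /IHs sE]; rewrite big_cons sE addrC addrA subrK.
Qed.

Definition path_flow s : 'cV[R]_#|dd_arc D| := \col_a (enum_val a \in s)%:R.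

Lemma sum_path_flow s (P : pred (dd_arc D)) (F : dd_arc D -> R) : uniq s ->
  \sum_(a : 'I_#|dd_arc D| | P (enum_val a)) F (enum_val a) * path_flow s a 0 =
  \sum_(a <- s | P a) F a.
Proof.
move=> us.
under eq_bigr do rewrite mxE.
rewrite -(big_enum_val_cond P (fun a => F a * (a \in s)%:R)).
rewrite [RHS]big_mkcond (big_uniq _ us) [RHS]big_mkcond [LHS]big_mkcond.
apply: eq_bigr => a _.
by rewrite inE; case: (a \in s); case: (P a); rewrite ?mulr1 ?mulr0.
Qed.

Lemma network_flow_dd_vectors :
  @dd_vectors R n D `<=` fst @` @network_flow R n D.
Proof.
move=> y [s [rst sy]].
have layers := dd_path_layers rst.
have ul : uniq [seq (dd_layer (dd_tail a) : nat) | a <- s].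
  by rewrite layers iota_uniq.
have us : uniq s := map_uniq ul.
exists (y, path_flow s) => //; split=> /= [a||i].
- by rewrite !mxE ler0n.
- apply/matrixP => w k; rewrite ord1 !mxE -(dd_path_telescope _ rst).
  rewrite -(sum_path_flow predT _ us); apply: eq_bigr => a _.
  by rewrite mxE.
have [a sa [ai ->]] := sy i.
rewrite -(eq_bigr _ (fun b _ => mul1r (path_flow s b 0))).
pose P (b : dd_arc D) := dd_label b && (dd_layer (dd_tail b) == i :> nat).
rewrite (sum_path_flow P (fun=> 1) us) {}/P.
rewrite (perm_big _ (perm_to_rem sa)) big_cons ai eqxx andbT.
(* The layers of the arcs of [s] are distinct: [a] is the only arc leaving
   layer [i]. *)
have -> : \sum_(b <- rem a s |
    dd_label b && (dd_layer (dd_tail b) == i :> nat)) 1 = 0 :> R.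
  rewrite big_seq_cond big_pred0// => b; apply/negbTE/negP.
  move=> /andP[bs /andP[_ /eqP bi]].
  move: ul; rewrite (perm_uniq (perm_map _ (perm_to_rem sa))) /=.
  move=> /andP[/negP + _]; apply.
  by rewrite ai -bi; apply/mapP; exists b.
by case: (dd_label a) => //; exact/esym/addr0.
Qed.

Lemma polyhedral_proj_network_flow : polyhedral (fst @` @network_flow R n D).
Proof.
pose M : 'M[R]_(n, #|dd_arc D|) := \matrix_(i, a)
  (dd_label (enum_val a) && (dd_layer (dd_tail (enum_val a)) == i :> nat))%:R.
have -> : fst @` @network_flow R n D = [set M *m z | z in
    [set z : 'cV[R]_#|dd_arc D| | lev 0 z] `&`
    [set z : 'cV[R]_#|dd_arc D| |
      forall v, true -> (incidence_mx R D *m z) v 0 = unit_flow_rhs R D v 0]].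
  have ME z i : (M *m z) i 0 =
      \sum_(a : 'I_#|dd_arc D| | dd_label (enum_val a) &&
          (dd_layer (dd_tail (enum_val a)) == i :> nat)) z a 0.
    rewrite mxE [RHS]big_mkcond; apply: eq_bigr => a _.
    by rewrite mxE; case: ifP; rewrite ?mul1r ?mul0r.
  apply/seteqP; split=> [_ [[y z] /= [z0 Az yz] <-]|_ [z [z0 Az] <-]].
    exists z; first by split=> // v _; rewrite Az.
    by apply/matrixP => i k; rewrite ord1 ME yz.
  exists (M *m z, z) => //; split=> //=.
  by apply/matrixP => v k; rewrite ord1 Az.
apply: polyhedral_image; apply: polyhedralI; first exact: polyhedral_lev_l.
apply: polyhedral_forall => v _.
exact: (polyhedral_preimage _ (polyhedral_coord_eq v _)).
Qed.

End Flows.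

(** * The polyhedron of relaxed second-stage decisions *)

Section Constraints.
Variables (R : realType) (m n q : nat).

Lemma binary_vectors_finite k : finite_set (@binary_vectors R k).
Proof.
have fin : finite_set (range (fun f : {ffun 'I_k -> bool} =>
    \col_i (f i)%:R : 'cV[R]_k)).
  exact: finite_image finite_finset.
apply: sub_finite_set fin => v v01.
exists [ffun i => v i 0 == 1] => //; apply/matrixP => i j.
rewrite ord1 !mxE ffunE.
by case: (v01 i) => ->; rewrite ?eqxx// eq_sym oner_eq0.
Qed.

Lemma relaxation_binary_points (G : 'M[R]_(q, n)) (h : 'cV[R]_q) :
  binary_points G h `<=` relaxation G h.
Proof.
by move=> y [y01 Gy]; split=> // i; case: (y01 i) => ->; rewrite lexx ler01.
Qed.

Lemma polyhedral_relaxation (G : 'M[R]_(q, n)) (h : 'cV[R]_q) :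
  polyhedral (relaxation G h).
Proof.
have -> : relaxation G h =
    ([set y : 'cV[R]_n | lev 0 y] `&` [set y : 'cV[R]_n | lev y (const_mx 1)])
    `&` [set y | lev h (G *m y)].
  apply/seteqP; split=> [y [y01 Gy]|y [[y0 y1] Gy]].
    by split=> //; split=> i; case/andP: (y01 i); rewrite mxE.
  by split=> // i; move: (y0 i) (y1 i); rewrite !mxE => -> ->.
apply: polyhedralI.
  by apply: polyhedralI; [exact: polyhedral_lev_l|exact: polyhedral_lev_r].
exact: (polyhedral_preimage _ (polyhedral_lev_l h)).
Qed.

Lemma polyhedral_selective (U1 U2 U3 : {set 'I_n * 'I_m}) (x : 'cV[R]_m) :
  polyhedral (selective U1 U2 U3 x).
Proof.
have -> : selective U1 U2 U3 x =
    [set y | forall ij, ij \in U1 -> y ij.1 0 <= x ij.2 0] `&`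
    ([set y | forall ij, ij \in U2 -> y ij.1 0 = x ij.2 0] `&`
     [set y | forall ij, ij \in U3 -> x ij.2 0 <= y ij.1 0]).
  apply/seteqP; split=> [y [y1 y2 y3]|y [y1 [y2 y3]]].
    by split; [|split] => -[i j]; auto.
  by split=> i j ij; [exact: (y1 (i, j))|exact: (y2 (i, j))|exact: (y3 (i, j))].
apply: polyhedralI; last apply: polyhedralI; apply: polyhedral_forall => ij _.
- exact: polyhedral_coord_le.
- exact: polyhedral_coord_eq.
- exact: polyhedral_coord_ge.
Qed.

End Constraints.

Lemma finite_set_argmin (R : realType) (T : choiceType) (A : set T)
    (f : T -> R) :
  finite_set A -> A !=set0 -> exists2 x, A x & forall y, A y -> f x <= f y.
Proof.
move=> /finite_seqP[s ->] [x0 /= xs].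
have /(tnthP (in_tuple s))[j0 _] := xs.
case: (@arg_minP _ _ _ j0 predT (fun j => f (tnth (in_tuple s) j)) isT).
move=> j _ jmin.
exists (tnth (in_tuple s) j); first exact: mem_tnth.
by move=> y /= /(tnthP (in_tuple s))[i ->]; exact: jmin.
Qed.

Definition second_stage (R : realType) (m n q : nat)
    (G : 'M[R]_(q, n)) (h : 'cV[R]_q) (U1 U2 U3 : {set 'I_n * 'I_m})
    (D : decision_diagram n) (x : 'cV[R]_m) :
    set 'cV[R]_n :=
  (fst @` @network_flow R n D) `&` (relaxation G h `&` selective U1 U2 U3 x).

(** * The decision diagram model *)

(** Lets the worst-case cost of [x], which may be infinite, be replaced by the
    reals [v] above it, to which [robust_dual] applies. *)
Lemma lee_of_real_upper_bounds (R : realType) (a b : \bar R) :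
  (forall r : R, (b < r%:E)%E -> (a <= r%:E)%E) -> (a <= b)%E.
Proof.
case: b => [b||] ab; [|exact: leey|].
  apply/lee_addgt0Pr => e e0.
  by rewrite -EFinD; apply: ab; rewrite lte_fin ltrDl.
case: a ab => [a /(_ (a - 1))|/(_ 0)|] //; rewrite ltNyr => /(_ isT) //.
by rewrite lee_fin lerBrDl gerDr ler10.
Qed.

Section Model.
Variables (R : realType) (m n p q : nat) (c : 'cV[R]_m) (X : set 'cV[R]_m).
Variables (G : 'M[R]_(q, n)) (h : 'cV[R]_q) (T : 'M[R]_(p, n)) (d : 'cV[R]_p).
Variables (U1 U2 U3 : {set 'I_n * 'I_m}) (D : decision_diagram n).

Local Notation Q := (second_stage G h U1 U2 U3 D).
Local Notation feasible := (dd_model_feasible X G h T U1 U2 U3 D).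
Local Notation optimal := (dd_model_optimal c X G h T d U1 U2 U3 D).

Lemma feasibleE x y lam :
  feasible (x, y, lam) <->
  [/\ T^T *m lam = y, Q x (T^T *m lam), X x & lev 0 lam].
Proof.
by split=> [[-> NFy rely Sy [Xx lam0]]|[<- [NFy [rely Sy]] Xx lam0]]; split.
Qed.

Lemma polyhedral_second_stage x : polyhedral (Q x).
Proof.
apply: polyhedralI (polyhedral_proj_network_flow _ _) _.
exact: polyhedralI (polyhedral_relaxation _ _) (polyhedral_selective _ _ _ _).
Qed.

(** For fixed [x] the model is a linear program in [lam], bounded below by weak
    duality: for a scenario [xi], [d . lam >= xi . (T^T lam)], and the entries
    of [T^T lam] lie between 0 and 1. *)
Lemma second_stage_optimal x : uncertainty_set T d !=set0 ->
  (exists lam, lev 0 lam /\ Q x (T^T *m lam)) ->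
  exists lam, (lev 0 lam /\ Q x (T^T *m lam)) /\
    forall lam', lev 0 lam' -> Q x (T^T *m lam') -> dotv d lam <= dotv d lam'.
Proof.
move=> [xi Txi] [lam0 lam0P].
pose P := [set lam : 'cV[R]_p | lev 0 lam] `&` [set lam | Q x (T^T *m lam)].
have polyP : polyhedral P.
  apply: polyhedralI (polyhedral_lev_l 0) _.
  exact: (polyhedral_preimage _ (polyhedral_second_stage x)).
have [|lam [Plam lam_min]] := polyhedral_min (f := d)
    (L := - \sum_i `|xi i 0|) polyP (ex_intro _ lam0 lam0P).
  move=> lam [lam0' [_ [[y01 _] _]]].
  apply: le_trans (weak_duality Txi lam0').
  rewrite dotvE -sumrN; apply: ler_sum => i _.
  set t := (T^T *m lam) i 0; have /andP[t0 t1] : 0 <= t <= 1 := y01 i.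
  rewrite lerNl; apply: le_trans (ler_norm _) _.
  by rewrite normrN normrM ler_piMr// ger0_norm.
by exists lam; split=> // lam' l0 Ql; exact: lam_min.
Qed.

(** The model minimises the optimal values of its linear programs over the
    finitely many [x] in [X] for which they are feasible. *)
Lemma dd_model_attained : X `<=` @binary_vectors R m ->
  uncertainty_set T d !=set0 -> feasible !=set0 -> exists w, optimal w.
Proof.
move=> Xbin Xi0 [[[x0 y0] lam0] /feasibleE[_ Q0 Xx0 l0]].
pose X' := X `&` [set x | exists lam, lev 0 lam /\ Q x (T^T *m lam)].
have finX' : finite_set X'.
  by apply: sub_finite_set (binary_vectors_finite R m) => x [/Xbin].
pose best_dual x lam := (lev 0 lam /\ Q x (T^T *m lam)) /\
  forall lam', lev 0 lam' -> Q x (T^T *m lam') -> dotv d lam <= dotv d lam'.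
have [best bestP] : {best & forall x, X' x -> best_dual x (best x)}.
  apply: (@choice _ _ (fun x lam => X' x -> best_dual x lam)) => x.
  have [[_ /(second_stage_optimal Xi0)[lam lamP]]|nX'] := pselect (X' x).
    by exists lam.
  by exists 0.
have [|x X'x xmin] :=
  finite_set_argmin (fun x => dotv c x + dotv d (best x)) finX'.
  by exists x0; split=> //; exists lam0.
have [[bx0 Qbx] _] := bestP x X'x.
exists (x, T^T *m best x, best x); split.
  by apply/feasibleE; split=> //; case: X'x.
move=> [[x' y'] lam'] /feasibleE[_ Qx' Xx' l'] /=.
have X'x' : X' x' by split=> //; exists lam'.
apply: le_trans (xmin x' X'x') _.
by rewrite lerD2l; have [_] := bestP x' X'x'; exact.
Qed.

(** If no binary decision is compatible with [x], then the worst-case cost of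
    [x] is infinite, because there is at least one scenario, and no real [r]
    lies above it. *)
Lemma dd_model_value_le : relaxed_dd D (binary_points G h) ->
  uncertainty_set T d !=set0 ->
  (dd_model_value c X G h T d U1 U2 U3 D
     <= two_stage_value c X G h T d U1 U2 U3)%E.
Proof.
move=> relD Xi0; apply: le_ereal_inf_tmp => _ [x Xx <-].
apply: lee_of_real_upper_bounds => r supr.
have [|||xi Txi|lam [lam0 Qlam dlam]] := @robust_dual R n p T d
    (binary_points G h `&` selective U1 U2 U3 x) (Q x) (r - dotv c x) Xi0.
- by apply: sub_finite_set (binary_vectors_finite R n) => y [[]].
- exact: polyhedral_second_stage.
- move=> y [Yy Sy]; split; first exact/network_flow_dd_vectors/relD.
  by split=> //; exact: relaxation_binary_points.
- have /ereal_inf_lt[_ [y yP <-]] :=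
    le_lt_trans (ereal_sup_ubound (ex_intro2 _ _ xi Txi erefl)) supr.
  by rewrite lte_fin => ylt; exists y => //; rewrite ltrBrDl.
apply: (@le_trans _ _ (dd_model_objective c d (x, T^T *m lam, lam))%:E).
  apply: ereal_inf_lbound; exists (x, T^T *m lam, lam) => //.
  exact/feasibleE.
by rewrite lee_fin /= -lerBrDl.
Qed.
End Model.

Theorem proposition5 (R : realType) (m n p q : nat)
    (hm : (0 < m)%N) (hn : (0 < n)%N)
    (c : 'cV[R]_m) (X : set 'cV[R]_m)
    (hX : X `<=` @binary_vectors R m)
    (G : 'M[R]_(q, n)) (h : 'cV[R]_q)
    (T : 'M[R]_(p, n)) (d : 'cV[R]_p)
    (hXi0 : uncertainty_set T d !=set0)
    (hXib : bounded_set (uncertainty_set T d))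
    (U1 U2 U3 : {set 'I_n * 'I_m})
    (hU12 : [disjoint U1 & U2]%bool) (hU13 : [disjoint U1 & U3]%bool)
    (hU23 : [disjoint U2 & U3]%bool)
    (Douter : decision_diagram n)
    (hD : relaxed_dd Douter (binary_points G h)) :
  [/\ dd_model_feasible X G h T U1 U2 U3 Douter !=set0 ->
        exists w, dd_model_optimal c X G h T d U1 U2 U3 Douter w,
      forall (x : 'cV[R]_m) (y : 'cV[R]_n) (lam : 'cV[R]_p),
        dd_model_optimal c X G h T d U1 U2 U3 Douter (x, y, lam) -> X x &
      (dd_model_value c X G h T d U1 U2 U3 Douter
         <= two_stage_value c X G h T d U1 U2 U3)%E].
Proof.
split; [exact: dd_model_attained | | exact: dd_model_value_le].
by move=> x y lam [/feasibleE[]].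
Qed.
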